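(* Let $n\ge 2$ and let $R$ be the $n\times n$ matrix with $(i,j)$ entry $\binom{i-1}{n-j}$, $1\le i,j\le n$. For an integer $e\ge1$ let $a^{(e)}_{i,j}$ denote the $(i,j)$ entry of $R^e$. Then for every $e\ge 1$ and all $2\le i\le n$, $2\le j\le n$, \[ F_{e-1}\,a^{(e)}_{i,j}=F_e\,a^{(e)}_{i-1,j}+F_{e+1}\,a^{(e)}_{i-1,j-1}-F_e\,a^{(e)}_{i,j-1}, \] where $(F_m)$ is the Fibonacci sequence.
   Context: Convention: $\binom{m}{k}=0$ if $k<0$ or $k>m$. The Fibonacci sequence is $F_0=0$, $F_1=1$, $F_{m+1}=F_m+F_{m-1}$. *)

(* Defs.v *)
From mathcomp Require Import all_boot all_order all_algebra.
Set Implicit Arguments.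
Unset Strict Implicit.
Unset Printing Implicit Defensive.
Import GRing.Theory.
Local Open Scope ring_scope.

Fixpoint fib (m : nat) : nat :=
  match m with
  | 0 => 0
  | 1 => 1
  | (k.+1 as k').+1 => fib k' + fib k
  end.

(* Indices are shifted to start at 0: the entry binom(i - 1, n - j),
   1 <= i, j <= n, becomes binom(i, n - (j + 1)), 0 <= i, j < n.  The
   truncated subtraction is exact because j < n. *)
Definition binom_mx (n : nat) : 'M[int]_n :=
  \matrix_(i < n, j < n) ('C(i, n - j.+1))%:Z.

(* Main.v *)
Require Import Defs.
From mathcomp Require Import all_boot all_order all_algebra.
From mathcomp Require Import zify ring.
Set Implicit Arguments.
Unset Strict Implicit.
Unset Printing Implicit Defensive.
Import GRing.Theory.
Local Open Scope ring_scope.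

(** With [u_e = F_(e-1) + F_e X], the generating polynomial of row [i]
    (counted from 0) of [R^e] is [u_e^(n-1-i) * u_(e+1)^i].  Indeed, by the
    binomial theorem, multiplying by [R] on the left replaces the pair [(u, v)]
    by [(v, u + v)].  Hence [u_e] times row [i] equals [u_(e+1)] times row
    [i-1], and the recurrence is the equality of the coefficients of [X^j]. *)

(** Reversing the index turns the summand into [u ^+ k * v ^+ (n - k.+1) *+ 'C(i, k)]. This vanishes
    for [k > i]; for [k <= i], splitting off [v ^+ (n - i.+1)] leaves the binomial expansion of
    [(u + v) ^+ i]. *)
Lemma sum_binom_homog (S : comNzRingType) (n i : nat) (u v : S) : (i < n)%N ->
  \sum_(k < n) (u ^+ (n - k.+1) * v ^+ k) *+ 'C(i, n - k.+1)
    = v ^+ (n - i.+1) * (u + v) ^+ i.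
Proof.
move=> lt_in; rewrite (reindex_inj rev_ord_inj) /=.
have rev_rev (k : 'I_n) : (n - (n - k.+1).+1 = k)%N.
  by have := ltn_ord k; lia.
under eq_bigr => k _ do rewrite rev_rev.
rewrite addrC exprDn mulr_sumr.
rewrite [RHS](eq_bigr (fun k : 'I_i.+1 =>
    (u ^+ k * v ^+ (n - k.+1)) *+ 'C(i, k))); last first.
  move=> k _; have le_ki : (k <= i)%N by rewrite -ltnS.
  rewrite mulrnAr mulrA -exprD mulrC; congr (_ * v ^+ _ *+ _); lia.
rewrite [RHS](big_ord_widen n (fun k => (u ^+ k * v ^+ (n - k.+1)) *+ 'C(i, k))) //.
rewrite [RHS]big_mkcond; apply: eq_bigr => k _ /=.
by case: ltnP => // lt_ik; rewrite bin_small.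
Qed.

Lemma rVpoly_row_binom_mul (n : nat) (A : 'M[int]_n) (u v : {poly int})
    (i : 'I_n) :
  (forall k : 'I_n, rVpoly (row k A) = u ^+ (n - k.+1) * v ^+ k) ->
  rVpoly (row i (binom_mx n *m A)) = v ^+ (n - i.+1) * (u + v) ^+ i.
Proof.
move=> rowA; rewrite -sum_binom_homog // row_mul mulmx_sum_row linear_sum /=.
by apply: eq_bigr => k _; rewrite !mxE linearZ /= rowA -scaler_nat natz.
Qed.

(** This is [u_(e+1)]: the shift avoids the predecessor in [F_(e-1)]. *)
Definition fib_poly (e : nat) : {poly int} :=
  (fib e)%:Z%:P + (fib e.+1)%:Z%:P * 'X.

Lemma fib_polyS2 (e : nat) : fib_poly e + fib_poly e.+1 = fib_poly e.+2.
Proof.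
have fibS2 m : (fib m.+2)%:Z%:P = (fib m.+1)%:Z%:P + (fib m)%:Z%:P :> {poly int}.
  by rewrite -polyCD -PoszD.
by rewrite /fib_poly (fibS2 e.+1) (fibS2 e); ring.
Qed.

Lemma rVpoly_row_binom_exp (n e : nat) (i : 'I_n) :
  rVpoly (row i (binom_mx n ^+ e.+1)) =
    fib_poly e ^+ (n - i.+1) * fib_poly e.+1 ^+ i.
Proof.
elim: e i => [|e IHe] i; last first.
  by rewrite exprS -fib_polyS2; apply: rVpoly_row_binom_mul.
have -> : fib_poly 0 = 'X by rewrite /fib_poly add0r mul1r.
have -> : fib_poly 1 = 1 + 'X by rewrite /fib_poly mul1r.
(* Row [k] of the identity matrix is ['X^k], so it has the required form for the pair [(1, 'X)],
   which [R] sends to [('X, 1 + 'X)]. *)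
rewrite exprS; apply: rVpoly_row_binom_mul => k.
by rewrite expr0 row1 rVpoly_delta expr1n mul1r.
Qed.

Lemma coefS_fib_poly_mul (e k : nat) (p : {poly int}) :
  (fib_poly e * p)`_k.+1 = (fib e)%:Z * p`_k.+1 + (fib e.+1)%:Z * p`_k.
Proof. by rewrite mulrDl coefD coefCM -mulrA coefCM coefXM. Qed.

Theorem theorem4 (n : nat) (hn : (2 <= n)%N) (e : nat) (he : (1 <= e)%N)
    (i i' j j' : 'I_n) (hi : nat_of_ord i = i'.+1) (hj : nat_of_ord j = j'.+1) :
  (fib e.-1)%:Z * (binom_mx n ^+ e) i j =
    (fib e)%:Z * (binom_mx n ^+ e) i' j
    + (fib e.+1)%:Z * (binom_mx n ^+ e) i' j'
    - (fib e)%:Z * (binom_mx n ^+ e) i j'.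
Proof.
case: e he => // e _; set A := _ ^+ _; rewrite [e.+1.-1]/=.
have rows : fib_poly e * rVpoly (row i A) = fib_poly e.+1 * rVpoly (row i' A).
  have eq_ni : (n - i'.+1 = (n - i.+1).+1)%N by have := ltn_ord i; lia.
  by rewrite !rVpoly_row_binom_exp eq_ni hi !exprS mulrA [RHS]mulrCA.
have coefA (k l : 'I_n) : (rVpoly (row k A))`_l = A k l.
  by rewrite coef_rVpoly_ord mxE.
(* Since [j = j'.+1], each linear factor contributes the entries in columns [j] and [j']; moving the
   [(i, j')] term across gives the minus sign. *)
have := congr1 (fun p : {poly int} => p`_j) rows.
by rewrite hj !coefS_fib_poly_mul -hj !coefA => <-; rewrite addrK.
Qed.
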